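(* Let $F\colon L\to H$ be a groupoid fibration of topological groupoids with fibre $G$. If both $H$ and $G$ are Hausdorff, then $L$ is Hausdorff. If both $H$ and $G$ are locally Hausdorff, then $L$ is locally Hausdorff. If $G$ and $H$ are locally Hausdorff and locally compact, then so is $L$.
   Context: A topological groupoid $L$ has (arbitrary) topological spaces $L^0$ of objects and $L^1$ of arrows, open continuous range and source maps $r,s\colon L^1\to L^0$, and continuous multiplication, inversion and unit maps. A groupoid fibration is a continuous functor $F\colon L\to H$ (continuous maps $F^i\colon L^i\to H^i$, $i=0,1$, compatible with $r$, $s$ and multiplication) such that $(F^1,s)\colon L^1\to H^1\times_{s,H^0,F^0}L^0=\{(h,x): s(h)=F^0(x)\}$ is an open surjection. Its fibre is the subgroupoid $G\subseteq L$ with $G^0=L^0$ and $G^1=\{g\in L^1: F^1(g)=1_{F^0(s(g))}\}$, with the subspace topology. A topological groupoid is called Hausdorff, locally Hausdorff, or locally compact if both its object space and its arrow space are. A space is locally Hausdorff if every point has a Hausdorff open neighbourhood. A locally Hausdorff space is locally compact if every neighbourhood of a point contains a compact Hausdorff neighbourhood of that point. *)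

(* Defs.v *)
From HB Require Import structures.
From mathcomp Require Import all_boot.
From mathcomp Require Import all_classical topology.

Set Implicit Arguments.
Unset Strict Implicit.
Unset Printing Implicit Defensive.

Local Open Scope classical_set_scope.

(* For [A : set T], the coercion to [set_type A] carries the subspace (initial)
   topology; it is used below for every subspace. *)

Definition open_map (X Y : topologicalType) (f : X -> Y) : Prop :=
  forall U : set X, open U -> open (f @` U).

Definition to_sub (T : Type) (A : set T) (x : T) (Ax : A x) : A :=
  exist _ x (mem_set Ax).

(* [gmul g h e] is the product gh; it is defined exactly when s(g) = r(h). *)
Record topGroupoid := TopGroupoid {
  gobj : topologicalType;
  garr : topologicalType;
  grng : garr -> gobj;
  gsrc : garr -> gobj;
  gunit : gobj -> garr;
  ginv : garr -> garr;
  gmul : forall g h : garr, gsrc g = grng h -> garr;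
  grng_unit : forall x, grng (gunit x) = x;
  gsrc_unit : forall x, gsrc (gunit x) = x;
  grng_inv : forall g, grng (ginv g) = gsrc g;
  gsrc_inv : forall g, gsrc (ginv g) = grng g;
  grng_mul : forall g h (e : gsrc g = grng h), grng (gmul e) = grng g;
  gsrc_mul : forall g h (e : gsrc g = grng h), gsrc (gmul e) = gsrc h;
  gmulA : forall g h k (e : gsrc g = grng h) (e' : gsrc h = grng k)
    (e1 : gsrc g = grng (gmul e')) (e2 : gsrc (gmul e) = grng k),
    gmul e1 = gmul e2;
  gmul1g : forall g (e : gsrc (gunit (grng g)) = grng g), gmul e = g;
  gmulg1 : forall g (e : gsrc g = grng (gunit (gsrc g))), gmul e = g;
  gmulVg : forall g (e : gsrc (ginv g) = grng g), gmul e = gunit (gsrc g);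
  gmulgV : forall g (e : gsrc g = grng (ginv g)), gmul e = gunit (grng g);
  grng_continuous : continuous grng;
  gsrc_continuous : continuous gsrc;
  grng_open : open_map grng;
  gsrc_open : open_map gsrc;
  gunit_continuous : continuous gunit;
  ginv_continuous : continuous ginv;
  gmul_continuous : continuous
    (fun p : [set q : garr * garr | gsrc q.1 = grng q.2] =>
       gmul (set_mem (valP p)))
}.

Arguments grng {t} _.
Arguments gsrc {t} _.
Arguments gunit {t} _.
Arguments ginv {t} _.
Arguments gmul {t} g h _.

Record topFunctor (L H : topGroupoid) := TopFunctor {
  fobj : gobj L -> gobj H;
  farr : garr L -> garr H;
  fobj_continuous : continuous fobj;
  farr_continuous : continuous farr;
  farr_rng : forall g, grng (farr g) = fobj (grng g);
  farr_src : forall g, gsrc (farr g) = fobj (gsrc g);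
  farr_mul : forall g h (e : gsrc g = grng h)
    (e' : gsrc (farr g) = grng (farr h)),
    farr (gmul g h e) = gmul (farr g) (farr h) e'
}.

Section fibration.
Variables (L H : topGroupoid) (F : topFunctor L H).

Definition src_pullback : set (garr H * gobj L) :=
  [set p | gsrc p.1 = fobj F p.2].

Definition fibration_map (g : garr L) : src_pullback :=
  @to_sub _ src_pullback (farr F g, gsrc g) (farr_src F g).

Definition groupoid_fibration : Prop :=
  open_map fibration_map /\ set_surj setT setT fibration_map.

Definition fibre_arr : set (garr L) :=
  [set g | farr F g = gunit (fobj F (gsrc g))].

End fibration.

Section groupoid_lemmas.
Variable G : topGroupoid.

Lemma gmul_congr (g g' h h' : garr G) e e' :
  g = g' -> h = h' -> gmul g h e = gmul g' h' e'.
Proof. by move=> eg eh; subst; congr (gmul _ _ _); exact: Prop_irrelevance. Qed.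

Lemma gmul1 x (g : garr G) (e : gsrc (gunit x) = grng g) : gmul _ _ e = g.
Proof.
have xg : x = grng g by rewrite -e gsrc_unit.
by subst x; exact: gmul1g.
Qed.

Lemma gmul1r x (g : garr G) (e : gsrc g = grng (gunit x)) : gmul _ _ e = g.
Proof.
have xg : x = gsrc g by rewrite e grng_unit.
by subst x; exact: gmulg1.
Qed.

Lemma ginv_uniq (g h : garr G) (e : gsrc g = grng h) :
  gmul g h e = gunit (grng g) -> h = ginv g.
Proof.
move=> gh.
have e0 : gsrc (ginv g) = grng g by rewrite gsrc_inv.
have e1 : gsrc (ginv g) = grng (gmul g h e) by rewrite gsrc_inv grng_mul.
have e2 : gsrc (gmul _ _ e0) = grng h by rewrite gsrc_mul.
have A := gmulA e1 e2.
have e3 : gsrc (gunit (gsrc g)) = grng h by rewrite gsrc_unit.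
have R : gmul _ _ e2 = h.
  by rewrite -[RHS](gmul1 e3); apply: gmul_congr => //; exact: gmulVg.
have e4 : gsrc (ginv g) = grng (gunit (grng g)).
  by rewrite gsrc_inv grng_unit.
have M : gmul _ _ e1 = ginv g.
  by rewrite -[RHS](gmul1r e4); exact: gmul_congr.
by rewrite -R -A M.
Qed.

Lemma ginvK : involutive (@ginv G).
Proof.
move=> g; have e : gsrc (ginv g) = grng g by rewrite gsrc_inv.
by apply/esym/(@ginv_uniq _ _ e); rewrite gmulVg grng_inv.
Qed.

Lemma gunit_idem (g : garr G) (e : gsrc g = grng g) :
  gmul g g e = g -> g = gunit (gsrc g).
Proof.
move=> gg.
have e0 : gsrc (ginv g) = grng g by rewrite gsrc_inv.
have e1 : gsrc (ginv g) = grng (gmul g g e) by rewrite gsrc_inv grng_mul.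
have e2 : gsrc (gmul _ _ e0) = grng g by rewrite gsrc_mul.
have A := gmulA e1 e2.
have e3 : gsrc (gunit (gsrc g)) = grng g by rewrite gsrc_unit.
have R : gmul _ _ e2 = g.
  by rewrite -[RHS](gmul1 e3); apply: gmul_congr => //; exact: gmulVg.
have M : gmul _ _ e1 = gunit (gsrc g).
  by rewrite -(gmulVg e0); exact: gmul_congr.
by rewrite -[LHS]R -A.
Qed.

End groupoid_lemmas.

Section functor_lemmas.
Variables (L H : topGroupoid) (F : topFunctor L H).

Lemma farr_unit x : farr F (gunit x) = gunit (fobj F x).
Proof.
have e : gsrc (farr F (gunit x)) = grng (farr F (gunit x)).
  by rewrite farr_src farr_rng gsrc_unit grng_unit.
have e' : gsrc (gunit x : garr L) = grng (gunit x).
  by rewrite gsrc_unit grng_unit.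
have := @gunit_idem _ _ e; rewrite farr_src gsrc_unit; apply.
by rewrite -(farr_mul e') gmul1.
Qed.

Lemma farr_inv g : farr F (ginv g) = ginv (farr F g).
Proof.
have e' : gsrc g = grng (ginv g) by rewrite grng_inv.
have e : gsrc (farr F g) = grng (farr F (ginv g)).
  by rewrite farr_src farr_rng grng_inv.
by apply: (@ginv_uniq _ _ _ e); rewrite -(farr_mul e') gmulgV farr_unit farr_rng.
Qed.

Lemma ginv_unit x : ginv (gunit x : garr L) = gunit x.
Proof.
have e : gsrc (gunit x : garr L) = grng (gunit x).
  by rewrite gsrc_unit grng_unit.
by apply/esym/(@ginv_uniq _ _ _ e); rewrite gmul1 grng_unit.
Qed.

End functor_lemmas.

Section fibre.
Variables (L H : topGroupoid) (F : topFunctor L H).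
Hypothesis hF : groupoid_fibration F.

Local Notation G1 := (fibre_arr F).

Lemma fibre_arrP (g : G1) : farr F (val g) = gunit (fobj F (gsrc (val g))).
Proof. exact: set_mem (valP g). Qed.

Lemma fibre_rng_src (g : G1) : fobj F (grng (val g)) = fobj F (gsrc (val g)).
Proof. by rewrite -farr_rng fibre_arrP grng_unit. Qed.

Lemma fibre_unit_subproof x : G1 (gunit x).
Proof. by rewrite /fibre_arr /= farr_unit gsrc_unit. Qed.

Lemma fibre_inv_subproof (g : G1) : G1 (ginv (val g)).
Proof.
rewrite /fibre_arr /= farr_inv fibre_arrP ginv_unit gsrc_inv.
by rewrite fibre_rng_src.
Qed.

Lemma fibre_mul_subproof (g h : G1) (e : gsrc (val g) = grng (val h)) :
  G1 (gmul _ _ e).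
Proof.
rewrite /fibre_arr /=.
have e' : gsrc (farr F (val g)) = grng (farr F (val h)).
  by rewrite farr_src farr_rng e.
rewrite (farr_mul e e') gsrc_mul -fibre_arrP.
have e2 : gsrc (gunit (fobj F (gsrc (val g)))) = grng (farr F (val h)).
  by rewrite -e' fibre_arrP.
by rewrite -[RHS](gmul1 e2); apply: gmul_congr => //; exact: fibre_arrP.
Qed.

Definition fibre_rng (g : G1) : gobj L := grng (val g).
Definition fibre_src (g : G1) : gobj L := gsrc (val g).
Definition fibre_unit (x : gobj L) : G1 := to_sub (fibre_unit_subproof x).
Definition fibre_inv (g : G1) : G1 := to_sub (fibre_inv_subproof g).
Definition fibre_mul (g h : G1) (e : fibre_src g = fibre_rng h) : G1 :=
  to_sub (fibre_mul_subproof e).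

Lemma val_continuous (X : topologicalType) (A : set X) :
  continuous (fun x : A => val x).
Proof. exact: (@initial_continuous A X set_val). Qed.

Lemma continuous_val (X Y : topologicalType) (A : set Y) (f : X -> A) :
  continuous (fun x => val (f x)) -> continuous f.
Proof. exact: continuous_comp_initial. Qed.

Lemma fibre_rng_continuous : continuous fibre_rng.
Proof.
move=> g; apply: (@continuous_comp _ _ _ (fun g : G1 => val g) grng).
  exact: val_continuous.
exact: grng_continuous.
Qed.

Lemma fibre_src_continuous : continuous fibre_src.
Proof.
move=> g; apply: (@continuous_comp _ _ _ (fun g : G1 => val g) gsrc).
  exact: val_continuous.
exact: gsrc_continuous.
Qed.

Lemma fibre_unit_continuous : continuous fibre_unit.
Proof. by apply: continuous_val; exact: gunit_continuous. Qed.

Lemma fibre_inv_continuous : continuous fibre_inv.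
Proof.
apply: continuous_val => g.
apply: (@continuous_comp _ _ _ (fun g : G1 => val g) ginv).
  exact: val_continuous.
exact: ginv_continuous.
Qed.

Lemma fibre_invK : involutive fibre_inv.
Proof. by move=> g; apply: val_inj; exact: ginvK. Qed.

Lemma unit_pullback_subproof x :
  src_pullback F (gunit (fobj F x), x).
Proof. by rewrite /src_pullback /= gsrc_unit. Qed.

Lemma fibre_src_open : open_map fibre_src.
Proof.
move=> V [W oW WV].
pose u (x : gobj L) : src_pullback F := to_sub (unit_pullback_subproof x).
have uc : continuous u.
  apply: continuous_val => x; apply: cvg_pair; last exact: cvg_id.
  apply: (@continuous_comp _ _ _ (fobj F) gunit).
    exact: fobj_continuous.
  exact: gunit_continuous.
have -> : fibre_src @` V = u @^-1` (fibration_map F @` W).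
  apply/seteqP; split => x /=.
    case=> g; rewrite -WV /= => Wg <-; exists (val g) => //.
    by apply: val_inj; rewrite /= fibre_arrP.
  case=> g Wg /(congr1 val) /= -[Fg gx].
  have gG : G1 g by rewrite /fibre_arr /= Fg gx.
  by exists (to_sub gG) => //; rewrite -WV.
by apply: open_comp => [y _|]; [exact: uc | exact: hF.1].
Qed.

Lemma fibre_rng_open : open_map fibre_rng.
Proof.
move=> V oV.
have -> : fibre_rng @` V = fibre_src @` (fibre_inv @^-1` V).
  apply/seteqP; split => x /= [g Vg <-].
    exists (fibre_inv g); rewrite ?fibre_invK //.
    by rewrite /fibre_src /= gsrc_inv.
  by exists (fibre_inv g) => //; rewrite /fibre_rng /= grng_inv.
by apply/fibre_src_open/open_comp => // y _; exact: fibre_inv_continuous.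
Qed.

Lemma fibre_mul_continuous : continuous
  (fun p : [set q : G1 * G1 | fibre_src q.1 = fibre_rng q.2] =>
     fibre_mul (set_mem (valP p))).
Proof.
apply: continuous_val.
pose D := [set q : garr L * garr L | gsrc q.1 = grng q.2].
pose D' := [set q : G1 * G1 | fibre_src q.1 = fibre_rng q.2].
have jP (p : D') : D (val (val p).1, val (val p).2).
  exact: (set_mem (valP p)).
pose j (p : D') : D := to_sub (jP p).
have c1 : continuous (fun p : D' => val (val p).1).
  move=> p; apply: (@continuous_comp _ _ _ (fun p : D' => (val p).1) val).
    apply: (@continuous_comp _ _ _ (fun p : D' => val p) fst).
      exact: val_continuous.
    exact: cvg_fst.
  exact: val_continuous.
have c2 : continuous (fun p : D' => val (val p).2).
  move=> p; apply: (@continuous_comp _ _ _ (fun p : D' => (val p).2) val).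
    apply: (@continuous_comp _ _ _ (fun p : D' => val p) snd).
      exact: val_continuous.
    exact: cvg_snd.
  exact: val_continuous.
have jc : continuous j.
  by apply: continuous_val => p; exact: (cvg_pair (c1 p) (c2 p)).
have -> : (fun p : D' => val (fibre_mul (set_mem (valP p)))) =
  (fun q : D => gmul _ _ (set_mem (valP q))) \o j.
  by apply/funext => p; exact: gmul_congr.
move=> p; apply: continuous_comp; first exact: jc.
exact: gmul_continuous.
Qed.

Program Definition fibre : topGroupoid := @TopGroupoid
  (gobj L) G1 fibre_rng fibre_src fibre_unit fibre_inv fibre_mul
  _ _ _ _ _ _ _ _ _ _ _
  fibre_rng_continuous fibre_src_continuous fibre_rng_open fibre_src_open
  fibre_unit_continuous fibre_inv_continuous fibre_mul_continuous.
Next Obligation. by move=> x; exact: grng_unit. Qed.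
Next Obligation. by move=> x; exact: gsrc_unit. Qed.
Next Obligation. by move=> g; exact: grng_inv. Qed.
Next Obligation. by move=> g; exact: gsrc_inv. Qed.
Next Obligation. by move=> g h e; exact: grng_mul. Qed.
Next Obligation. by move=> g h e; exact: gsrc_mul. Qed.
Next Obligation. by move=> g h k e e' e1 e2; apply: val_inj; exact: gmulA. Qed.
Next Obligation. by move=> g e; apply: val_inj; exact: gmul1g. Qed.
Next Obligation. by move=> g e; apply: val_inj; exact: gmulg1. Qed.
Next Obligation. by move=> g e; apply: val_inj; exact: gmulVg. Qed.
Next Obligation. by move=> g e; apply: val_inj; exact: gmulgV. Qed.

End fibre.

Definition locally_hausdorff_space (X : topologicalType) : Prop :=
  forall x : X, exists2 U : set X, open_nbhs x U & hausdorff_space U.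

(* The library's [locally_compact] asks for one neighbourhood with compact
   closure, a different notion when the space is not Hausdorff. *)
Definition locally_compact_space (X : topologicalType) : Prop :=
  forall (x : X) (N : set X), nbhs x N ->
    exists K : set X, [/\ nbhs x K, K `<=` N, compact K & hausdorff_space K].

Definition hausdorff_groupoid (G : topGroupoid) : Prop :=
  hausdorff_space (gobj G) /\ hausdorff_space (garr G).

Definition locally_hausdorff_groupoid (G : topGroupoid) : Prop :=
  locally_hausdorff_space (gobj G) /\ locally_hausdorff_space (garr G).

Definition locally_compact_groupoid (G : topGroupoid) : Prop :=
  locally_compact_space (gobj G) /\ locally_compact_space (garr G).

(* Main.v *)
(* Over [B], the pullback of [gobj L] and [garr H], the arrows of [L] behave like
   a principal bundle of the fibre [G]: two arrows [a], [b] with the same image in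
   [B] differ by the unique arrow [fdiv a b = a b^-1] of [G], and this quotient
   depends continuously on [(a, b)].

   (Locally) Hausdorff: limits of a filter in [garr L] have the same image in [B],
   and their quotient is a limit of units in [G], hence a unit.

   Locally compact: a compact neighbourhood of [g] is the set [K] of arrows [a]
   over a small compact subset of [B] such that [fdiv a b] lies in a fixed compact
   [Q] for all [b] near [g] with the image of [a]. The quantification over all [b],
   rather than some [b], is what makes [K] contain the limits of its ultrafilters;
   taking a closure instead would not do, as spaces need not be regular. *)
From mathcomp Require Import all_boot.
From mathcomp Require Import all_classical topology.
Require Import Defs.

Set Implicit Arguments.
Unset Strict Implicit.
Unset Printing Implicit Defensive.

Local Open Scope classical_set_scope.

(** * Filters, ultrafilters and Hausdorff subsets *)

Section topology.

Lemma nbhs_val (X : topologicalType) (A : set X) (x : A) (N : set A) :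
  nbhs x N ->
    exists2 M : set X, nbhs (val x : X) M & forall y : A, M (val y) -> N y.
Proof.
move=> Nx; rewrite nbhsE in Nx; have [_ [[O oO <-] Ox] ON] := Nx.
exists O; first exact: open_nbhs_nbhs.
by move=> y; exact: ON.
Qed.

Lemma cvg_val (T : Type) (X : topologicalType) (A : set X) (W : set_system T)
    (f : T -> A) (x : A) :
  Filter W -> (fun t => val (f t)) @ W --> val x -> f @ W --> x.
Proof.
move=> FW fx N /nbhs_val[M /fx Mx MN]; rewrite nbhs_simpl /=.
by apply: (filterS (fun t => MN (f t))); exact: Mx.
Qed.

Lemma hausdorff_lim (X : topologicalType) (x y : X) (F : set_system X) :
  hausdorff_space X -> ProperFilter F -> F --> x -> F --> y -> x = y.
Proof.
move=> hX FF Fx Fy; apply: hX => A B /Fx FA /Fy FB.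
by have /filter_ex : F (A `&` B) by exact: filterI.
Qed.

(** Stated with filters on the ambient space, so that limits in [A] can be compared without passing
    to the subtype. *)
Definition hausdorff_in (X : topologicalType) (A : set X) :=
  forall F : set_system X, ProperFilter F -> F A ->
  forall x y, A x -> A y -> F --> x -> F --> y -> x = y.

Lemma hausdorff_inP (X : topologicalType) (A : set X) :
  hausdorff_space A <-> hausdorff_in A.
Proof.
split=> [hA F FF FA x y Ax Ay Fx Fy|hA x y].
  apply: (congr1 val (x := to_sub Ax) (y := to_sub Ay)); apply: hA => M N.
  move=> /nbhs_val[M' /Fx FM MM] /nbhs_val[N' /Fy FN NN].
  have /filter_ex[z [[Mz Nz] Az]] : F (M' `&` N' `&` A).
    by apply: filterI => //; exact: filterI.
  by exists (to_sub Az); split; [exact: MM|exact: NN].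
(* A cluster point [y] of the neighbourhoods of [x] gives a proper filter converging to both; it is
   pushed forward along [val]. *)
rewrite cluster_cvgE => -[G PG [Gy Gx]]; apply: val_inj.
have vG (z : A) : G --> z -> val @ G --> val z.
  by move=> Gz; exact: (cvg_comp _ _ Gz (@val_continuous _ _ z)).
have Aval (z : A) : A (val z) by exact: set_mem (valP z).
apply: (hA (val @ G)); [|exact: Aval|exact: Aval|exact: vG|exact: vG].
by apply: (@filterE _ G) => z; exact: Aval.
Qed.

Lemma hausdorff_inT (X : topologicalType) :
  hausdorff_space X <-> hausdorff_in [set: X].
Proof.
split=> [hX F FF _ x y _ _|hX x y]; first exact: hausdorff_lim.
rewrite cluster_cvgE => -[G PG [Gy Gx]].
by apply: (hX G) => //; exact: filterT.
Qed.

Lemma sub_hausdorff_in (X : topologicalType) (A B : set X) :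
  A `<=` B -> hausdorff_in B -> hausdorff_in A.
Proof.
move=> AB hB F FF FA x y Ax Ay.
apply: hB => //; [exact: filterS FA|exact: AB|exact: AB].
Qed.

Lemma compact_ultra_cvg (T : Type) (X : topologicalType) (f : T -> X)
    (C : set X) (u : set_system T) :
  compact C -> UltraFilter u -> u (f @^-1` C) ->
  exists2 x, C x & f @ u --> x.
Proof.
move=> cC uu uC; have [x [Cx clx]] := cC (f @ u) _ uC.
exists x => // N Nx; have [//|unN] := in_ultra_setVsetC (f @^-1` N) uu.
by have [y [/= nNy /nNy]] := clx (~` N) N unN Nx.
Qed.

(** Brings limits found after lifting [u] back to [u]: if [u] missed [N], it would contain the
    complement, and [W] would contain two disjoint preimages. *)
Lemma ultra_cvg_extend (T : Type) (X : topologicalType) (f : T -> X)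
    (u : set_system X) (W : set_system T) (x : X) :
  UltraFilter u -> ProperFilter W -> (forall A, u A -> W (f @^-1` A)) ->
  f @ W --> x -> u --> x.
Proof.
move=> uu PW uW fx N /fx WN; have [//|/uW WnN] := in_ultra_setVsetC N uu.
by have /filter_ex[t []] : W (f @^-1` N `&` f @^-1` ~` N) by exact: filterI.
Qed.

End topology.

(** * Continuity of multiplication along filters *)

Lemma gmul_nbhs (G : topGroupoid) (g h : garr G) (e : gsrc g = grng h)
    (N : set (garr G)) : nbhs (gmul g h e) N ->
  exists A B, [/\ nbhs g A, nbhs h B &
    forall g' h' e', A g' -> B h' -> N (gmul g' h' e')].
Proof.
pose D := [set q : garr G * garr G | gsrc q.1 = grng q.2].
pose p : D := to_sub (e : D (g, h)).
have -> : gmul g h e = gmul _ _ (set_mem (valP p)) by exact: gmul_congr.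
move=> /(@gmul_continuous G p)/nbhs_val[M [[A B] /= [gA hB] ABM] MN].
exists A, B; split=> // g' h' e' Ag' Bh'.
have := MN (to_sub (e' : D (g', h'))) (ABM (g', h') (conj Ag' Bh')).
by rewrite /= [X in N X -> _](_ : _ = gmul g' h' e') //; exact: gmul_congr.
Qed.

(** Being a product only eventually lets [m] be a total map, although [f1 t] and [f2 t] need not
    always be composable. *)
Lemma gmul_cvg (G : topGroupoid) (T : Type) (W : set_system T)
    (f1 f2 m : T -> garr G) g h (e : gsrc g = grng h) :
  Filter W -> f1 @ W --> g -> f2 @ W --> h ->
  (\forall t \near W, exists e', m t = gmul (f1 t) (f2 t) e') ->
  m @ W --> gmul g h e.
Proof.
move=> FW f1g f2h Wm N /gmul_nbhs[A [B [/f1g WA /f2h WB ABN]]].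
have WAB : W (f1 @^-1` A `&` f2 @^-1` B) by exact: filterI.
rewrite nbhs_simpl /=; apply: filterS2 WAB Wm => t [At Bt] [e' mE].
by rewrite /= mE; exact: ABN.
Qed.

(** * Quotients of arrows with the same image in the pullback *)

Section fdiv.
Variables (L H : topGroupoid) (F : topFunctor L H).
Hypothesis hF : groupoid_fibration F.

(** Equality of the images under [fibration_map], componentwise. *)
Definition same_base (a b : garr L) := farr F a = farr F b /\ gsrc a = gsrc b.

Lemma div_composable (a b : garr L) : same_base a b -> gsrc a = grng (ginv b).
Proof. by case=> _; rewrite grng_inv. Qed.

Lemma fibre_arr_div (a b : garr L) (ab : same_base a b) :
  fibre_arr F (gmul a (ginv b) (div_composable ab)).
Proof.
have [Fab sab] := ab; rewrite /fibre_arr /=.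
have e : gsrc (farr F a) = grng (farr F (ginv b)).
  by rewrite farr_src farr_rng grng_inv sab.
rewrite (farr_mul _ e) gsrc_mul gsrc_inv -farr_rng -Fab.
have e' : gsrc (farr F a) = grng (ginv (farr F a)) by rewrite grng_inv.
by rewrite -(gmulgV e'); apply: gmul_congr => //; rewrite farr_inv -Fab.
Qed.

(* The quotient [a b^-1]; a junk unit when [a] and [b] are not over the same
   point of the pullback. *)
Definition fdiv (a b : garr L) : fibre_arr F :=
  match pselect (same_base a b) with
  | left ab => to_sub (fibre_arr_div ab)
  | right _ => fibre_unit F (grng a)
  end.

Lemma fdivE (a b : garr L) : same_base a b ->
  exists e, val (fdiv a b) = gmul a (ginv b) e.
Proof. by rewrite /fdiv; case: pselect => // ab _; exists (div_composable ab). Qed.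

Lemma fdivK (a b : garr L) : same_base a b ->
  exists e, a = gmul (val (fdiv a b)) b e.
Proof.
move=> ab; have [e E] := fdivE ab.
have e1 : gsrc (ginv b) = grng b by rewrite gsrc_inv.
have e2 : gsrc (gmul a (ginv b) e) = grng b by rewrite gsrc_mul.
have e3 : gsrc (val (fdiv a b)) = grng b by rewrite E.
have e4 : gsrc a = grng (gmul _ _ e1) by rewrite grng_mul.
exists e3; rewrite (gmul_congr e3 e2 E erefl) -(gmulA e4).
have e5 : gsrc a = grng (gunit (gsrc b)) by rewrite grng_unit; case: ab.
by rewrite -[LHS](gmul1r e5); apply: gmul_congr => //; rewrite gmulVg.
Qed.

Lemma fdiv_same (a : garr L) : val (fdiv a a) = gunit (grng a).
Proof. by have [//|e ->] := @fdivE a a; exact: gmulgV. Qed.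

Lemma same_base_mul (k : fibre_arr F) (g : garr L) e :
  same_base (gmul (val k) g e) g.
Proof.
split; last exact: gsrc_mul.
have e' : gsrc (farr F (val k)) = grng (farr F g) by rewrite farr_src farr_rng e.
have e2 : gsrc (gunit (fobj F (gsrc (val k)))) = grng (farr F g).
  by rewrite gsrc_unit farr_rng e.
rewrite (farr_mul e e') -[RHS](gmul1 e2).
by apply: gmul_congr => //; exact: fibre_arrP.
Qed.

Lemma fdiv_mul (k : fibre_arr F) (g : garr L) e :
  fdiv (gmul (val k) g e) g = k.
Proof.
apply: val_inj; have [e1 ->] := fdivE (same_base_mul e).
have e2 : gsrc g = grng (ginv g) by rewrite grng_inv.
have e3 : gsrc (val k) = grng (gmul _ _ e2) by rewrite grng_mul.
rewrite -(gmulA e3).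
have e4 : gsrc (val k) = grng (gunit (grng g)) by rewrite grng_unit.
by rewrite -[RHS](gmul1r e4); apply: gmul_congr => //; rewrite gmulgV.
Qed.

Lemma fdiv_cvg (T : Type) (W : set_system T) (f1 f2 : T -> garr L) a b :
  Filter W -> f1 @ W --> a -> f2 @ W --> b ->
  (\forall t \near W, same_base (f1 t) (f2 t)) -> same_base a b ->
  (fun t => fdiv (f1 t) (f2 t)) @ W --> fdiv a b.
Proof.
move=> FW f1a f2b Wbase ab; apply: cvg_val; have [e ->] := fdivE ab.
apply: (@gmul_cvg _ _ _ f1 (fun t => ginv (f2 t))) => //.
  exact: (cvg_comp _ _ f2b (@ginv_continuous L b)).
by apply: filterS Wbase => t; exact: fdivE.
Qed.

(** * Hausdorff properties of the arrow space *)

Lemma fdiv_nbhs (g : garr L) (N : set (fibre_arr F)) :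
  nbhs (fibre_unit F (grng g)) N ->
  exists2 U, open_nbhs g U &
    forall a b, U a -> U b -> same_base a b -> N (fdiv a b).
Proof.
have <- : fdiv g g = fibre_unit F (grng g).
  by apply: val_inj; rewrite fdiv_same.
(* Approaching [(g, g)] only through [P] avoids the junk values of [fdiv]. *)
pose P := [set p : garr L * garr L | same_base p.1 p.2].
have c1 : fst @ within P (nbhs (g, g)) --> g.
  by apply: cvg_trans (@cvg_fst _ _ (nbhs g) (nbhs g) _); exact/cvg_app/cvg_within.
have c2 : snd @ within P (nbhs (g, g)) --> g.
  by apply: cvg_trans (@cvg_snd _ _ (nbhs g) (nbhs g) _); exact/cvg_app/cvg_within.
move=> Ng; have := fdiv_cvg _ c1 c2 (withinT _ _) (conj erefl erefl) Ng.
rewrite nbhs_simpl /= => -[[A B] /= [Ag Bg] ABN].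
have : nbhs g (A `&` B) by exact: filterI.
rewrite nbhsE => -[U gU UAB]; exists U => // a b Ua Ub ab.
by apply: (ABN (a, b)) => //=; split; [have [] := UAB _ Ua|have [] := UAB _ Ub].
Qed.

(* If a filter converges to both [a] and [b], then so does its diagonal to
   [(a, b)], and dividing shows that a filter of units converges both to
   [a b^-1] and to [b b^-1]. *)
Lemma hausdorff_in_arr (U : set (garr L)) (V : set (garr H)) (X : set (gobj L))
    (W : set (fibre_arr F)) :
  U `<=` farr F @^-1` V -> U `<=` gsrc @^-1` X ->
  (forall a b, U a -> U b -> same_base a b -> W (fdiv a b)) ->
  hausdorff_in V -> hausdorff_in X -> hausdorff_in W -> hausdorff_in U.
Proof.
move=> UV UX UW hV hX hW u uu uU a b Ua Ub ua ub.
have Fu c : u --> c -> farr F @ u --> farr F c.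
  by move=> uc; exact: (cvg_comp _ _ uc (@farr_continuous _ _ F c)).
have su c : u --> c -> gsrc @ u --> gsrc c.
  by move=> uc; exact: (cvg_comp _ _ uc (@gsrc_continuous L c)).
have ab : same_base a b.
  split.
    apply: (hV (farr F @ u)); [|exact: UV|exact: UV|exact: Fu|exact: Fu].
    exact: (@filterS _ u _ U).
  apply: (hX (gsrc @ u)); [|exact: UX|exact: UX|exact: su|exact: su].
  exact: (@filterS _ u _ U).
have refl l : same_base l l by [].
have near_refl : \forall l \near u, same_base l l by exact: filterE.
have E : fdiv a b = fdiv b b.
  apply: (hW ((fun l => fdiv l l) @ u)).
  - by apply: (@filterS _ u _ U) uU => l Ul; exact: (UW l l).
  - exact: UW.
  - by apply: UW.
  - exact: fdiv_cvg.
  - exact: fdiv_cvg.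
have [e ->] := fdivK ab; have [e' bE] := fdivK (refl b).
by rewrite [RHS]bE; apply: gmul_congr => //; rewrite E.
Qed.

Lemma hausdorff_arr :
  hausdorff_groupoid H -> hausdorff_groupoid (fibre hF) ->
  hausdorff_space (garr L).
Proof.
move=> [_ /hausdorff_inT hH] [/hausdorff_inT hL0 /hausdorff_inT hG].
by apply/hausdorff_inT; exact: (hausdorff_in_arr _ _ _ hH hL0 hG).
Qed.

(** Near [g], images in [H], sources, and quotients (close to a unit) all stay in Hausdorff open
    sets, so [hausdorff_in_arr] applies. *)
Lemma locally_hausdorff_arr :
  locally_hausdorff_groupoid H -> locally_hausdorff_groupoid (fibre hF) ->
  locally_hausdorff_space (garr L).
Proof.
move=> [_ hH] [hL0 hG] g.
have [V [oV Vg] /hausdorff_inP hV] := hH (farr F g).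
have [X [oX Xg] /hausdorff_inP hX] := hL0 (gsrc g).
have [W Wg /hausdorff_inP hW] := hG (fibre_unit F (grng g)).
have [U [oU Ug] UW] := fdiv_nbhs (open_nbhs_nbhs Wg).
exists (U `&` (farr F @^-1` V `&` (@gsrc L) @^-1` X)).
  split; last by [].
  apply: openI => //; apply: openI.
    by apply: open_comp => // y _; exact: farr_continuous.
  by apply: open_comp => // y _; exact: gsrc_continuous.
apply/hausdorff_inP; apply: (hausdorff_in_arr _ _ _ hV hX hW).
- by move=> x [_ []].
- by move=> x [_ []].
- by move=> a b [Ua _] [Ub _]; exact: UW.
Qed.

(** * Lifting ultrafilters along the fibration *)

Lemma fibration_image_nbhs (U : set (garr L)) (g : garr L) : open_nbhs g U ->
  exists A B, [/\ nbhs (farr F g) A, nbhs (gsrc g) B &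
    forall h x, A h -> B x -> gsrc h = fobj F x ->
      exists2 a, U a & farr F a = h /\ gsrc a = x].
Proof.
move=> [oU Ug]; pose p := fibration_map F g.
have : nbhs p (fibration_map F @` U).
  by apply: open_nbhs_nbhs; split; [exact: hF.1|exists g].
move=> /nbhs_val[M [[A B] /= [Ag Bg] ABM] MU]; exists A, B; split=> // h x Ah Bx e.
have [a Ua /(congr1 val)/= [Fa sa]] :=
  MU (to_sub (e : src_pullback F (h, x))) (ABM (h, x) (conj Ah Bx)).
by exists a.
Qed.

(** The product of [u] with the neighbourhoods of [g], restricted to [same_base], is proper:
    openness of [fibration_map] gives arrows of [u]-large sets a partner near [g]. Any ultrafilter
    refining it will do. *)
Lemma fibration_lift_ultra (u : set_system (garr L)) (g : garr L) :
  ProperFilter u -> farr F @ u --> farr F g -> gsrc @ u --> gsrc g ->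
  exists W : set_system (garr L * garr L), [/\ UltraFilter W,
    W [set p | same_base p.1 p.2], (forall A, u A -> W (fst @^-1` A)) &
    snd @ W --> g].
Proof.
move=> uu uF us; pose P := [set p : garr L * garr L | same_base p.1 p.2].
have PW : ProperFilter (within P (filter_prod u (nbhs g))).
  apply: Build_ProperFilter_ex => N [[A B] /= [uA]]; rewrite nbhsE => -[U gU UB] ABN.
  have [C [D [/uF uC /us uD CDU]]] := fibration_image_nbhs gU.
  have /filter_ex[a [Aa [Ca Da]]] : u (A `&` (farr F @^-1` C `&` gsrc @^-1` D)).
    by apply: filterI => //; exact: filterI.
  have [b Ub [Fb sb]] := CDU _ _ Ca Da (farr_src F a).
  by exists (a, b); apply: (ABN (a, b)); split=> //=; exact: UB.
have [W [uW sW]] := ultraFilterLemma PW; exists W; split=> //.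
- by apply: sW; exact: withinT.
- move=> A uA; apply: sW; apply: (@cvg_within _ (filter_prod u (nbhs g)) _ P).
  exact: (@cvg_fst _ _ u (nbhs g)).
- move=> B gB; apply: sW; apply: (@cvg_within _ (filter_prod u (nbhs g)) _ P).
  exact: (@cvg_snd _ _ u (nbhs g)).
Qed.

(* Lift the image of an ultrafilter [u] near [g]: then [a] in [u] is [k b] with
   [b] near [g], and compactness makes the quotients [k] converge. *)
Lemma fibration_ultra_cvg (u : set_system (garr L)) (g : garr L)
    (K U : set (garr L)) (O : set (gobj L)) (Q : set (fibre_arr F)) :
  UltraFilter u -> farr F @ u --> farr F g -> gsrc @ u --> gsrc g ->
  u K -> nbhs g U ->
  (forall a b, K a -> U b -> same_base a b -> Q (fdiv a b)) -> compact Q ->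
  hausdorff_in O -> open O -> O (grng g) -> Q `<=` @fibre_src L H F @^-1` O ->
  exists k e, Q k /\ u --> gmul (val k) g e.
Proof.
move=> uu uF us uK gU KUQ cQ hO oO Og QO.
have [W [uW Wbase WK Wg]] := fibration_lift_ultra _ uF us.
have WKU : \forall p \near W, Q (fdiv p.1 p.2).
  have WU : W (snd @^-1` U) by exact: Wg.
  have : W ((fst @^-1` K) `&` (snd @^-1` U) `&` [set p | same_base p.1 p.2]).
    by apply: (@filterI _ W) => //; apply: (@filterI _ W) => //; exact: WK.
  by apply: (@filterS _ W) => p [[Kp Up] Pp]; exact: KUQ.
have [k Qk Wk] := compact_ultra_cvg cQ uW WKU.
have Wrng : (fun p => grng p.2) @ W --> grng g.
  exact: (cvg_comp _ _ Wg (@grng_continuous L g)).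
have Wsrc : (fun p => grng p.2) @ W --> fibre_src k.
  have Wsk : (fun p => fibre_src (fdiv p.1 p.2)) @ W --> fibre_src k.
    exact: (cvg_comp _ _ Wk (@fibre_src_continuous L H F k)).
  apply: cvg_trans Wsk; apply: near_eq_cvg.
  by apply: (@filterS _ W _ _ _ _ Wbase) => p /fdivK[e _]; rewrite /fibre_src e.
have e : gsrc (val k) = grng g.
  apply: (hO ((fun p => grng p.2) @ W)) => //; last exact: QO.
  by apply: Wrng; exact: open_nbhs_nbhs.
exists k, e; split=> //.
apply: (@ultra_cvg_extend _ _ fst _ W) => //.
apply: (gmul_cvg _ _ Wg).
  exact: (cvg_comp _ _ Wk (@val_continuous _ _ k)).
by apply: (@filterS _ W _ _ _ _ Wbase) => p /fdivK.
Qed.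

(** * Local compactness of the arrow space *)

Lemma locally_compact_arr :
  locally_hausdorff_groupoid H -> locally_compact_groupoid H ->
  locally_hausdorff_groupoid (fibre hF) ->
  locally_compact_groupoid (fibre hF) -> locally_compact_space (garr L).
Proof.
move=> lH [_ cH1] lG [cL0 cG1] g0 N0 N0g0.
have [U1 [oU1 U1g0] /hausdorff_inP hU1] := locally_hausdorff_arr lH lG g0.
have [O [oO Og0] /hausdorff_inP hO] : exists2 O : set (gobj L),
  open_nbhs (grng g0) O & hausdorff_space O by exact: lG.1.
have [OH [oOH OHg0] /hausdorff_inP hOH] := lH.1 (gsrc (farr F g0)).
have e0 : gsrc (val (fibre_unit F (grng g0))) = grng g0 by rewrite /= gsrc_unit.
(* Writing [g0] as a unit times [g0] yields neighbourhoods [M] of the unit and [V] of [g0] whose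
   products stay in [U1] and [N0]. *)
have Ng0 : nbhs (gmul _ _ e0) (U1 `&` N0).
  have -> : gmul _ _ e0 = g0 by exact: gmul1.
  by apply: filterI => //; exact: open_nbhs_nbhs.
have [M [V [Mu Vg0 MVN]]] := gmul_nbhs Ng0.
(* Sources of [Q] lie in the Hausdorff set [O], so that limits of quotients remain composable with
   the arrows of [V'] below. *)
have [Q [Qu QMO cQ _]] : exists Q : set (fibre_arr F),
    [/\ nbhs (fibre_unit F (grng g0)) Q,
    Q `<=` val @^-1` M `&` @fibre_src L H F @^-1` O, compact Q & hausdorff_space Q].
  apply: (cG1 (fibre_unit F (grng g0))); apply: filterI.
    exact: (@val_continuous _ _ (fibre_unit F (grng g0))).
  apply: (@fibre_src_continuous L H F); apply: open_nbhs_nbhs; split=> //.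
  by rewrite /fibre_src e0.
have [V1 [oV1 V1g0] V1Q] := fdiv_nbhs Qu.
have [V' [oV' V'g0] V'V] : exists2 V', open_nbhs g0 V' &
    V' `<=` V1 `&` (V `&` (@grng L) @^-1` O).
  have : nbhs g0 (V1 `&` (V `&` (@grng L) @^-1` O)).
    apply: filterI; first exact: open_nbhs_nbhs.
    by apply: filterI => //; apply: grng_continuous; exact: open_nbhs_nbhs.
  by rewrite nbhsE.
have [A [B [Ag0 Bg0 ABV']]] := fibration_image_nbhs (conj oV' V'g0).
have [C1 [C1g0 C1A cC1 _]] : exists C, [/\ nbhs (farr F g0) C,
    C `<=` A `&` (@gsrc H) @^-1` OH, compact C & hausdorff_space C].
  apply: cH1; apply: filterI => //.
  by apply: gsrc_continuous; exact: open_nbhs_nbhs.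
have [C2 [C2g0 C2B cC2 _]] : exists C : set (gobj L), [/\ nbhs (gsrc g0) C,
    C `<=` B `&` fobj F @^-1` OH, compact C & hausdorff_space C].
  apply: cL0; apply: filterI => //.
  apply: (@fobj_continuous _ _ F (gsrc g0)); rewrite -farr_src.
  exact: open_nbhs_nbhs.
pose K := [set a | [/\ C1 (farr F a), C2 (gsrc a) &
  forall b, V' b -> same_base a b -> Q (fdiv a b)]].
(* Lifts in [V'] exist, so the universal condition in [K] is never vacuous. *)
have over h x : C1 h -> C2 x -> gsrc h = fobj F x ->
    exists2 b, V' b & farr F b = h /\ gsrc b = x.
  by move=> /C1A[Ah _] /C2B[Bx _]; exact: ABV'.
have KN : K `<=` U1 `&` N0.
  move=> a [Ca1 Ca2 aQ].
  have [b V'b [Fb sb]] := over _ _ Ca1 Ca2 (farr_src F a).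
  have ab : same_base a b by [].
  have [e ->] := fdivK ab; apply: MVN.
    by have /QMO[] := aQ b V'b ab.
  by have [_ []] := V'V _ V'b.
exists K; split.
- have : nbhs g0 (V' `&` (farr F @^-1` C1 `&` (@gsrc L) @^-1` C2)).
    apply: filterI; first exact: open_nbhs_nbhs.
    apply: filterI; first exact: farr_continuous.
    exact: gsrc_continuous.
  apply: (@filterS _ (nbhs g0)) => a [V'a [Ca1 Ca2]]; split=> // b V'b.
  by apply: V1Q; [have [] := V'V _ V'a|have [] := V'V _ V'b].
- by move=> a /KN[].
- rewrite compact_ultra => u uu uK.
  have [h C1h uh] : exists2 h, C1 h & farr F @ u --> h.
    by apply: compact_ultra_cvg => //; apply: (@filterS _ u _ K) uK => a [].
  have [x C2x ux] : exists2 x, C2 x & gsrc @ u --> x.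
    by apply: compact_ultra_cvg => //; apply: (@filterS _ u _ K) uK => a [].
  (* The limit [(h, x)] lies in the pullback because both sides are limits of one filter inside the
     Hausdorff set [OH]. *)
  have hx : gsrc h = fobj F x.
    have uh' : (fun a => gsrc (farr F a)) @ u --> gsrc h.
      exact: (cvg_comp _ _ uh (@gsrc_continuous H h)).
    have ux' : (fun a => gsrc (farr F a)) @ u --> fobj F x.
      rewrite (_ : (fun a => _) = fobj F \o gsrc); last exact/funext/farr_src.
      exact: (cvg_comp _ _ ux (@fobj_continuous _ _ F x)).
    have OHh : OH (gsrc h) by have [] := C1A _ C1h.
    apply: (hOH ((fun a => gsrc (farr F a)) @ u)) => //.
      by apply: uh'; exact: open_nbhs_nbhs.
    by have [] := C2B _ C2x.
  have lim b : V' b -> farr F b = h -> gsrc b = x ->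
      exists k e, Q k /\ u --> gmul (val k) b e.
    move=> V'b Fb sb; rewrite -Fb in uh; rewrite -sb in ux.
    apply: (fibration_ultra_cvg uu uh ux uK _ _ cQ hO oO).
    + exact: (open_nbhs_nbhs (conj oV' V'b)).
    + by move=> a c [_ _]; exact.
    + by have [_ []] := V'V _ V'b.
    + by move=> k /QMO[].
  have [b V'b [Fb sb]] := over _ _ C1h C2x hx.
  have [k [e [Qk ukb]]] := lim b V'b Fb sb.
  exists (gmul (val k) b e); split=> //.
  have [Fkb skb] := same_base_mul e.
  split; [by rewrite Fkb Fb|by rewrite skb sb|].
  (* Any other lift [c] gives a second limit [k' c] of [u]. Both limits lie in the Hausdorff set
     [U1], so they agree, and the quotient by [c] is [k'], which lies in [Q]. *)
  move=> c V'c [Fc sc].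
  have [||k' [e' [Qk' ukc]]] := lim c V'c.
  - by rewrite -Fc Fkb Fb.
  - by rewrite -sc skb sb.
  have inU1 k1 c1 (e1 : gsrc (val k1) = grng c1) :
      Q k1 -> V' c1 -> U1 (gmul (val k1) c1 e1).
    by move=> /QMO[Mk1 _] /V'V[_ [Vc1 _]]; have [] := MVN _ _ e1 Mk1 Vc1.
  rewrite (_ : gmul (val k) b e = gmul (val k') c e') ?fdiv_mul //.
  apply: (hU1 u) => //; [|exact: inU1|exact: inU1].
  by apply: (@filterS _ u _ K) uK => a /KN[].
- by apply/hausdorff_inP; apply: sub_hausdorff_in hU1 => a /KN[].
Qed.

End fdiv.

Theorem theorem4p1 (L H : topGroupoid) (F : topFunctor L H)
    (hF : groupoid_fibration F) :
  (hausdorff_groupoid H /\ hausdorff_groupoid (fibre hF) ->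
     hausdorff_groupoid L) /\
  (locally_hausdorff_groupoid H /\ locally_hausdorff_groupoid (fibre hF) ->
     locally_hausdorff_groupoid L) /\
  ((locally_hausdorff_groupoid (fibre hF) /\
      locally_compact_groupoid (fibre hF)) /\
   (locally_hausdorff_groupoid H /\ locally_compact_groupoid H) ->
     locally_hausdorff_groupoid L /\ locally_compact_groupoid L).
Proof.
(* The fibre has the same object space as [L], so only arrow spaces need an argument. *)
split=> [[hH hG]|]; first by split; [exact: hG.1|exact: (hausdorff_arr hH hG)].
have locH : locally_hausdorff_groupoid H ->
    locally_hausdorff_groupoid (fibre hF) -> locally_hausdorff_groupoid L.
  by move=> hH hG; split; [exact: hG.1|exact: (locally_hausdorff_arr hH hG)].
split=> [[hH hG]|[[hG cG] [hH cH]]]; first exact: locH.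
split; first exact: locH.
by split; [exact: cG.1|exact: (locally_compact_arr hH cH hG cG)].
Qed.
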